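(* Let $\langle T,\bar\mu\rangle$ be a probability tree. Then there is a unique probability measure $\lambda^{\bar\mu}$ on the Borel $\sigma$-algebra $\mathcal B([T])$ such that, for any $t\in T$, $\lambda^{\bar\mu}([t]_T)=\Xi^{\bar\mu}(\{t\})$.
   Context: A tree (of sequences) is a non-empty set $T$ of finite sequences with entries in some set, closed under initial segments and ordered by $s\subseteq t$ ($t$ extends $s$). $\mathrm{succ}_T(t)$ is the set of $t'\in T$ extending $t$ with $|t'|=|t|+1$; $\max T$ is the set of $t\in T$ with $\mathrm{succ}_T(t)=\emptyset$; $\lim T$ is the set of infinite sequences $x$ (indexed by $\omega$) with $x\upharpoonright n\in T$ for all $n<\omega$; $[T]=\lim T\cup\max T$, with the topology generated by the sets $[t]_T=\{x\in[T] : t\subseteq x\}$, $t\in T$. A probability tree is a pair $\langle T,\bar\mu\rangle$ where $T$ is a countable tree of sequences and $\bar\mu=\langle\mu_t : t\in T\smallsetminus\max T\rangle$ with each $\mu_t$ a probability measure on $\mathcal P(\mathrm{succ}_T(t))$. $\Xi^{\bar\mu}$ is the measure on $\mathcal P(T)$ determined by $\Xi^{\bar\mu}(\{t\})=\prod_{k<|t|}\mu_{t\upharpoonright k}(\{t\upharpoonright(k+1)\})$ for $t\in T$ (the empty product is $1$). *)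

(* Defs.v *)
From HB Require Import structures.
From mathcomp Require Import all_boot all_order all_algebra.
From mathcomp Require Import all_classical all_reals all_analysis.

Set Implicit Arguments.
Unset Strict Implicit.
Unset Printing Implicit Defensive.

Import Order.TTheory GRing.Theory Num.Theory.
Import numFieldNormedType.Exports.

Local Open Scope classical_set_scope.
Local Open Scope ring_scope.
Local Open Scope ereal_scope.

(* Sequences of length at most omega: [inl] for the finite ones, [inr] for the
   ones indexed by omega. *)
Definition sequence (A : Type) : Type := (seq A + (nat -> A))%type.

(* s is the restriction of t to |s|. The equation [take (size s) u = s] forces
   [size s <= size u]. *)
Definition initseg (A : Type) (s : seq A) (t : sequence A) : Prop :=
  match t with
  | inl u => take (size s) u = s
  | inr x => mkseq x (size s) = s
  end.

Record tree (A : Type) := Tree {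
  nodes : set (seq A);
  tree_nonempty : nodes !=set0;
  tree_closed : forall s t, nodes t -> initseg s (inl t) -> nodes s
}.

Section trees.
Context (A : Type) (T : tree A).

Definition succ (t : seq A) : set (seq A) :=
  [set s | [/\ nodes T s, initseg t (inl s) & size s = (size t).+1]].

Definition tmax : set (seq A) := [set t | nodes T t /\ succ t = set0].

Definition tlim : set (nat -> A) := [set x | forall n, nodes T (mkseq x n)].

Definition node : Type := {t : seq A | nodes T t}.

(* T minus max T *)
Definition inner : Type := {t : seq A | (nodes T `\` tmax) t}.

Definition succ_node (t : inner) : Type := {s : seq A | succ (sval t) s}.

(* [T] *)
Definition branch : Type :=
  {x : sequence A | (inr @` tlim `|` inl @` tmax) x}.

(* [t]_T *)
Definition cylinder (t : node) : set branch :=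
  [set x | initseg (sval t) (sval x)].

Lemma tree_take (t : seq A) k : nodes T t -> nodes T (take k t).
Proof.
move=> Tt; apply: (tree_closed Tt) => /=; rewrite size_take.
by case: ltnP => // h; rewrite take_size take_oversize.
Qed.

Lemma tree_nil : nodes T [::].
Proof. by have [t Tt] := tree_nonempty T; rewrite -(take0 t); exact: tree_take. Qed.

Lemma succ_take (t : seq A) k : nodes T t -> (k < size t)%N ->
  succ (take k t) (take k.+1 t).
Proof.
move=> Tt kt; split; first exact: tree_take.
- by rewrite /= size_take kt take_takel.
- rewrite !size_take kt; case: ltnP => // h.
  by apply/eqP; rewrite eqn_leq h kt.
Qed.

Lemma inner_take (t : seq A) k : nodes T t -> (k < size t)%N ->
  (nodes T `\` tmax) (take k t).
Proof.
move=> Tt kt; split; first exact: tree_take.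
by case=> _ /seteqP[+ _] => /(_ (take k.+1 t)); apply; exact: succ_take.
Qed.

Lemma succ_node_inh (t : inner) : $| succ_node t |.
Proof.
case: t => t [Tt nmax].
have /set0P[s ts] : succ t != set0 by apply/eqP => t0; exact: nmax.
by squash (exist _ s ts : succ_node (exist _ t (conj Tt nmax))).
Qed.

Lemma branch_inh : $| branch |.
Proof.
have [[t tm]|nomax] := pselect (exists t, tmax t).
  have h : (inr @` tlim `|` inl @` tmax) (inl t : sequence A).
    by right; exists t.
  by squash (exist _ (inl t) h : branch).
have next t : nodes T t -> exists a, nodes T (rcons t a).
  move=> Tt; have /set0P[s [Ts /= st ss]] : succ t != set0.
    by apply/eqP => t0; apply: nomax; exists t.
  case: (lastP s) st ss Ts => [//|u a] st; rewrite size_rcons => -[ut] Tua.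
  move: st; rewrite -cats1 -ut take_cat ltnn subnn take0 cats0 => <-.
  by exists a.
have [a0 _] := next _ tree_nil.
have /choice[g gP] t : exists a, nodes T t -> nodes T (rcons t a).
  have [/next[a ?]|nTt] := pselect (nodes T t); first by exists a.
  by exists a0.
pose f n := iter n (fun t => rcons t (g t)) [::].
have fT n : nodes T (f n) by elim: n => [|n IH]; [exact: tree_nil|exact: gP].
have fE n : mkseq (g \o f) n = f n.
  by elim: n => // n IH; rewrite mkseqS IH.
have h : (inr @` tlim `|` inl @` tmax) (inr (g \o f) : sequence A).
  by left; exists (g \o f) => // n; rewrite fE.
by squash (exist _ (inr (g \o f)) h : branch).
Qed.

End trees.

Section structures.
Context (A : Type) (T : tree A).

HB.instance Definition _ := gen_eqMixin (node T).
HB.instance Definition _ := gen_choiceMixin (node T).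
HB.instance Definition _ :=
  isPointed.Build (node T) (exist (nodes T) [::] (tree_nil T)).
HB.instance Definition _ := @isMeasurable.Build default_measure_display
  (node T) discrete_measurable discrete_measurable0
  discrete_measurableC discrete_measurableU.

HB.instance Definition _ (t : inner T) := gen_eqMixin (succ_node t).
HB.instance Definition _ (t : inner T) := gen_choiceMixin (succ_node t).
HB.instance Definition _ (t : inner T) :=
  isPointed.Build (succ_node t) (unsquash (succ_node_inh t)).
HB.instance Definition _ (t : inner T) :=
  @isMeasurable.Build default_measure_display
  (succ_node t) discrete_measurable discrete_measurable0
  discrete_measurableC discrete_measurableU.

HB.instance Definition _ := gen_eqMixin (branch T).
HB.instance Definition _ := gen_choiceMixin (branch T).
HB.instance Definition _ :=
  isPointed.Build (branch T) (unsquash (branch_inh T)).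
HB.instance Definition _ :=
  isSubBaseTopological.Build (branch T) setT (@cylinder A T).

(* [T] with its Borel sigma-algebra *)
Definition borel_branch := g_sigma_algebraType (@open (branch T)).

HB.instance Definition _ := Measurable.on borel_branch.

End structures.

Record probability_tree (R : realType) (A : Type) := ProbabilityTree {
  ptree : tree A;
  ptree_countable : countable (nodes ptree);
  pmeas : forall t : inner ptree, probability (succ_node t) R
}.

Section Xi.
Context (R : realType) (A : Type) (P : probability_tree R A).
Local Notation T := (ptree P).

(* The mass that mu_(t|k) gives to {t|(k+1)}. *)
Definition step (t : node T) (k : 'I_(size (sval t))) : \bar R :=
  pmeas (exist (nodes T `\` tmax T) (take k (sval t))
               (inner_take (svalP t) (ltn_ord k)))
        [set s | sval s = take k.+1 (sval t)].

Definition Xi (B : set (node T)) : \bar R :=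
  \esum_(t in B) \prod_(k < size (sval t)) step k.

Lemma step_prod_ge0 (t : node T) : 0 <= \prod_(k < size (sval t)) step k.
Proof. by apply: prode_ge0 => k _; exact: measure_ge0. Qed.

Lemma Xi_set1 (t : node T) : Xi [set t] = \prod_(k < size (sval t)) step k.
Proof. by rewrite /Xi esum_set1 // step_prod_ge0. Qed.

Lemma Xi_set0 : Xi set0 = 0.
Proof. exact: esum_set0. Qed.

Lemma Xi_ge0 B : 0 <= Xi B.
Proof. by apply: esum_ge0 => t _; exact: step_prod_ge0. Qed.

Lemma Xi_semi_sigma_additive : semi_sigma_additive Xi.
Proof.
move=> F mF tF mUF; rewrite /Xi nneseries_sum_bigcup //; last first.
  by move=> t; exact: step_prod_ge0.
by apply: is_cvg_nneseries => n _ _; exact: Xi_ge0.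
Qed.

HB.instance Definition _ := isMeasure.Build _ _ _ Xi
  Xi_set0 Xi_ge0 Xi_semi_sigma_additive.

End Xi.

Arguments Xi {R A} P B.

(* Main.v *)
From HB Require Import structures.
Require Import Defs.
From mathcomp Require Import all_boot all_order all_algebra.
From mathcomp Require Import all_classical all_reals all_analysis.

Import Order.TTheory GRing.Theory Num.Theory.
Import numFieldNormedType.Exports.

(* Give each node t the half-open interval I_t of length Xi {t}, with
   I_() = [0, 1[, the intervals of the children of t being laid side by side
   inside I_t in the order of a fixed enumeration e of the nodes. The masses
   mu_t sum to 1, so the children's intervals partition I_t exactly. Hence each
   x in [0, 1[ determines a unique branch f x whose initial segments are the t
   with x in I_t, and the preimage of [t]_T under f is I_t: the law of f under
   Lebesgue measure is the required probability, with sigma-additivity for free.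
   Uniqueness holds because the cylinders with the empty set form a pi-system,
   which generates the Borel sets since T is countable. *)

Local Open Scope classical_set_scope.
Local Open Scope ereal_scope.

Set Implicit Arguments.
Unset Strict Implicit.
Unset Printing Implicit Defensive.

Lemma takel_rcons (A : Type) (t : seq A) a k : (k <= size t)%N ->
  take k (rcons t a) = take k t.
Proof. by move=> kt; rewrite -cats1 takel_cat. Qed.

(** * Cylinders: a countable pi-system generating the Borel sets *)

Section cylinders.
Context (A : Type) (T : tree A).
Implicit Types (s t : seq A) (b : Defs.sequence A).

Lemma take_mkseq (x : nat -> A) m n : (m <= n)%N ->
  take m (mkseq x n) = mkseq x m.
Proof. by move=> mn; rewrite /mkseq -map_take take_iota (minn_idPl mn). Qed.

Lemma initseg_trans s t b : initseg s (inl t) -> initseg t b -> initseg s b.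
Proof.
move=> /= st; have st_size : (size s <= size t)%N.
  by rewrite -st size_take_min geq_minr.
by case: b => [u|x] /= tb;
  rewrite -[RHS]st -[in RHS]tb (take_takel, take_mkseq).
Qed.

Lemma initseg_comparable s t b : (size s <= size t)%N ->
  initseg s b -> initseg t b -> initseg s (inl t).
Proof.
case: b => [u|x] /= st su tu; first by rewrite -tu take_takel.
by rewrite -tu take_mkseq.
Qed.

Lemma succP t s : succ T t s <-> nodes T s /\ exists x, s = rcons t x.
Proof.
split=> [[Ts /= st ss]|[Ts [x sE]]]; last first.
  by split; rewrite // sE /= ?size_rcons // -cats1 take_size_cat.
split=> //; case: (lastP s) st ss => [//|u x] st; rewrite size_rcons => -[ut].
exists x; congr rcons; move: st.
by rewrite -cats1 -ut take_size_cat.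
Qed.

Definition pi_cylinder : set (set (branch T)) :=
  [set B | B = set0 \/ exists t : node T, B = cylinder t].

(** Two cylinders with a common branch are nested: both nodes are initial segments of that branch,
    so the shorter is one of the longer, whose cylinder is the intersection. *)
Lemma pi_cylinder_setI : setI_closed pi_cylinder.
Proof.
move=> B C [->|[s ->]]; first by left; rewrite set0I.
move=> [->|[t ->]]; first by left; rewrite setI0.
wlog st : s t / (size (sval s) <= size (sval t))%N => [wl|].
  have [st|/ltnW ts] := leqP (size (sval s)) (size (sval t)); first exact: wl.
  by rewrite setIC; exact: wl.
have [[c [sb tb]]|ex] := pselect ((cylinder s `&` cylinder t) !=set0).
  right; exists t; apply/seteqP; split=> [d []//|d td]; split=> //.
  by apply: initseg_trans td; exact: initseg_comparable st sb tb.
by left; apply/seteqP; split=> // c sb; apply: ex; exists c.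
Qed.

Lemma cylinder_nil : cylinder (point : node T) = setT.
Proof.
by apply/seteqP; split=> // -[[u|x] h] _ //=; rewrite /cylinder /= take0.
Qed.

Lemma countable_node : countable (nodes T) -> countable [set: node T].
Proof.
move=> /countable_injP[e eI]; apply/countable_injP; exists (e \o sval).
move=> [s Ts] [t Tt] _ _ /= /eI; rewrite !inE => /(_ Ts Tt) st.
by move: Tt; rewrite -st => Tt; congr exist; exact: Prop_irrelevance.
Qed.

Lemma cylinder_open (t : node T) : open (cylinder t).
Proof.
exists [set cylinder t]; last by rewrite bigcup_set1.
by move=> _ ->; exact: finI_from1.
Qed.

(** An open set is a union of finite intersections of cylinders. With countably many nodes there are
    only countably many such intersections, so the union is a countable one. *)
Lemma borel_branchE : countable (nodes T) ->
  @measurable _ (borel_branch T) = <<s pi_cylinder >>.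
Proof.
move=> /countable_node cT; apply/seteqP; split; last first.
  apply: smallest_sub; first exact: smallest_sigma_algebra.
  move=> B [->|[t ->]]; first exact: (@measurable0 _ (borel_branch T)).
  by apply: sub_sigma_algebra; exact: cylinder_open.
apply: smallest_sub; first exact: smallest_sigma_algebra.
move=> _ [D DI <-].
(* Viewing the generated sigma-algebra as a measurable type gives access to closure under countable
   unions and finite intersections. *)
pose gT : measurableType _ := g_sigma_algebraType pi_cylinder.
change (@measurable _ gT (\bigcup_(B in D) B)).
rewrite bigcup_set_type; apply: countable_bigcupT_measurable => [|B].
  apply: (@sub_countable _ _ _ D); first by rewrite (card_le_eql (card_setT D)).
  apply: sub_countable (finI_from_countable (@cylinder A T) cT).
  exact: subset_card_le.
have /DI[N _ <-] := set_valP B.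
rewrite bigcap_fset; apply: bigsetI_measurable => t _.
by apply: sub_sigma_algebra; right; exists t.
Qed.

End cylinders.

(** * Nested half-open intervals attached to the nodes *)

Section intervals.
Context (R : realType) (A : Type) (P : probability_tree R A).
Local Notation T := (ptree P).
Variable e : seq A -> nat.
Hypothesis eI : {in nodes T &, injective e}.
Implicit Types (s t : seq A) (B C : set (seq A)) (x y : R).
Local Open Scope ring_scope.

(* mu_t as a real function of sets of sequences; 0 when t is not inner. *)
Definition children_mass t B : R :=
  if pselect ((nodes T `\` tmax T) t) is left h
  then fine (pmeas (exist (nodes T `\` tmax T) t h) [set s | B (sval s)])
  else 0.

Lemma children_massE t (h : (nodes T `\` tmax T) t) B :
  (children_mass t B)%:E =
  pmeas (exist (nodes T `\` tmax T) t h) [set s | B (sval s)].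
Proof.
rewrite /children_mass; case: pselect => // h'.
by rewrite fineK ?fin_num_measure // (Prop_irrelevance h h').
Qed.

(** Only the trace on the children of [t] matters, because the measure lives on [succ_node t]. *)
Lemma le_children_mass t B C : succ T t `&` B `<=` C ->
  children_mass t B <= children_mass t C.
Proof.
move=> BC; have [h|nh] := pselect ((nodes T `\` tmax T) t); last first.
  by rewrite /children_mass; case: pselect.
rewrite -lee_fin !(children_massE h); apply: le_measure; rewrite ?inE //.
by move=> [s ss] /= Bs; exact: BC.
Qed.

Lemma eq_children_mass t B C : succ T t `&` B = succ T t `&` C ->
  children_mass t B = children_mass t C.
Proof.
move=> BC; apply/eqP; rewrite eq_le !le_children_mass //.
  by rewrite -BC => s [].
by rewrite BC => s [].
Qed.

Lemma children_mass_ge0 t B : 0 <= children_mass t B.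
Proof.
have [h|nh] := pselect ((nodes T `\` tmax T) t); last first.
  by rewrite /children_mass; case: pselect.
by rewrite -lee_fin (children_massE h) measure_ge0.
Qed.

Lemma children_mass_le1 t B : children_mass t B <= 1.
Proof.
have [h|nh] := pselect ((nodes T `\` tmax T) t); last first.
  by rewrite /children_mass; case: pselect.
by rewrite -lee_fin (children_massE h) probability_le1.
Qed.

Lemma children_massU t B C : B `&` C = set0 ->
  children_mass t (B `|` C) = children_mass t B + children_mass t C.
Proof.
move=> BC; have [h|nh] := pselect ((nodes T `\` tmax T) t); last first.
  by rewrite /children_mass; case: pselect => //; rewrite addr0.
apply: EFin_inj; rewrite EFinD !(children_massE h) -measureU //.
apply/seteqP; split=> // s /= Bs.
by have : (B `&` C) (sval s) by []; rewrite BC.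
Qed.

(** The strict inequality makes this the relative left end of the child with index [n]; its relative
    right end is the value at [n.+1]. *)
Definition children_cdf t n := children_mass t [set s | (e s < n)%N].

Lemma children_cdf_ge0 t n : 0 <= children_cdf t n.
Proof. exact: children_mass_ge0. Qed.

Lemma children_cdf_le1 t n : children_cdf t n <= 1.
Proof. exact: children_mass_le1. Qed.

Lemma children_cdf0 t : children_cdf t 0 = 0.
Proof.
rewrite /children_cdf (_ : [set s | _] = set0); last first.
  by apply/seteqP; split.
(* Additivity on two copies of the empty set gives c = c + c, hence c = 0. *)
have /eqP := children_massU t (setI0 set0).
by rewrite setU0 eq_sym -subr_eq0 addrK => /eqP.
Qed.

Lemma le_children_cdf t m n : (m <= n)%N ->
  children_cdf t m <= children_cdf t n.
Proof. by move=> mn; apply: le_children_mass => s [_ /= /leq_trans]; apply. Qed.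

Lemma children_cdfS t n : children_cdf t n.+1 =
  children_cdf t n + children_mass t [set s | e s = n].
Proof.
rewrite -children_massU; last first.
  by apply/seteqP; split=> // s /= [+ es]; rewrite es ltnn.
congr children_mass; apply/seteqP; split=> s /=.
  by rewrite ltnS leq_eqVlt => /orP[/eqP|]; [right|left].
by move=> [/ltnW|->].
Qed.

(** Continuity from below along sets that exhaust the children. The limit 1 is what leaves no gap at
    the right end of the parent interval. *)
Lemma children_cdf_cvg t : nodes T t -> ~ tmax T t ->
  children_cdf t n @[n --> \oo] --> (1 : R).
Proof.
move=> Tt tm; have h : (nodes T `\` tmax T) t by [].
set mu := pmeas (exist (nodes T `\` tmax T) t h).
pose F n := [set s : succ_node (exist (nodes T `\` tmax T) t h) |
  (e (sval s) < n)%N].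
have FT : \bigcup_n F n = setT.
  by apply/seteqP; split=> // s _; exists (e (sval s)).+1; rewrite /F /=.
have : (mu \o F) n @[n --> \oo] --> mu (\bigcup_n F n).
  apply: nondecreasing_cvg_mu => // m n mn; apply/subsetPset => s.
  by rewrite /F /= => /leq_trans; apply.
rewrite FT probability_setT => /fine_cvgP[_].
have -> // : fine \o (mu \o F) = children_cdf t.
apply/funext => n; rewrite /children_cdf /children_mass /=.
by case: pselect => // h'; rewrite /mu (Prop_irrelevance h h').
Qed.

Definition weight t : R :=
  \prod_(k < size t) children_mass (take k t) [set take k.+1 t].

(** At each level the left end moves by the length of the ancestor's interval times the mass of the
    siblings enumerated earlier. *)
Definition left_end t : R := \sum_(k < size t)
  weight (take k t) * children_cdf (take k t) (e (take k.+1 t)).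

Definition node_itv t : set R := `[left_end t, left_end t + weight t[.

Lemma weight_ge0 t : 0 <= weight t.
Proof. by apply: prodr_ge0 => k _; exact: children_mass_ge0. Qed.

Lemma weight_rcons t a :
  weight (rcons t a) = weight t * children_mass t [set rcons t a].
Proof.
rewrite /weight size_rcons big_ord_recr /= takel_rcons // take_size.
rewrite [take _.+1 _]take_oversize ?size_rcons //; congr (_ * _).
by apply: eq_bigr => k _; rewrite !takel_rcons // ltnW.
Qed.

Lemma left_end_rcons t a : left_end (rcons t a) =
  left_end t + weight t * children_cdf t (e (rcons t a)).
Proof.
rewrite /left_end size_rcons big_ord_recr /= takel_rcons // take_size.
rewrite [take _.+1 _]take_oversize ?size_rcons //; congr (_ + _).
by apply: eq_bigr => k _; rewrite !takel_rcons // ltnW.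
Qed.

Lemma node_itv_nil : node_itv [::] = `[0, 1[%classic.
Proof. by rewrite /node_itv /left_end /weight !big_ord0 add0r. Qed.

(** Since [e] is injective on nodes, the mass of this child is one increment of [children_cdf t];
    the child's endpoints become two consecutive values of it, rescaled to the parent. *)
Lemma node_itv_rcons t a : nodes T (rcons t a) ->
  node_itv (rcons t a) =
  `[left_end t + weight t * children_cdf t (e (rcons t a)),
    left_end t + weight t * children_cdf t (e (rcons t a)).+1[%classic.
Proof.
move=> Tta; rewrite children_cdfS.
have <- : children_mass t [set rcons t a] =
    children_mass t [set s | e s = e (rcons t a)].
  apply: eq_children_mass; apply/seteqP; split=> s [ts] /= es.
    by split=> //=; rewrite es.
  by case: (ts) => Ts _ _; split=> //=; apply: eI; rewrite ?inE.
by rewrite /node_itv left_end_rcons weight_rcons mulrDr addrA.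
Qed.

Lemma node_itv_sub_rcons t a : nodes T (rcons t a) ->
  node_itv (rcons t a) `<=` node_itv t.
Proof.
move=> Tta; rewrite node_itv_rcons // /node_itv => x /=; rewrite !in_itv /=.
move=> /andP[le_x lt_x]; apply/andP; split.
  by apply: le_trans le_x; rewrite lerDl mulr_ge0 ?weight_ge0 ?children_cdf_ge0.
by rewrite (lt_le_trans lt_x) // lerD2l ler_piMr ?weight_ge0 ?children_cdf_le1.
Qed.

Lemma node_itv_sub_take t k : nodes T t -> node_itv t `<=` node_itv (take k t).
Proof.
elim/last_ind: t => [|t a IH] Tta; first by rewrite take_oversize.
have Tt : nodes T t.
  by have := tree_take (size t) Tta; rewrite takel_rcons // take_size.
have [kt|tk] := leqP k (size t); last by rewrite take_oversize // size_rcons.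
rewrite takel_rcons //.
exact: subset_trans (node_itv_sub_rcons Tta) (IH Tt).
Qed.

(** Intervals on one level are disjoint. By nesting and induction the parents agree; of two
    siblings, the one enumerated first ends no later than the other begins. *)
Lemma node_itv_inj s t x : nodes T s -> nodes T t -> size s = size t ->
  node_itv s x -> node_itv t x -> s = t.
Proof.
elim/last_ind: s t => [|s a IH] t; first by move=> _ _ /esym/size0nil.
case: (lastP t) => [|{}t b]; first by move=> _ _; rewrite size_rcons.
move=> Tsa Ttb; rewrite !size_rcons => -[st] xsa xtb.
have Ts : nodes T s.
  by have := tree_take (size s) Tsa; rewrite takel_rcons // take_size.
have Tt : nodes T t.
  by have := tree_take (size t) Ttb; rewrite takel_rcons // take_size.
have {}st : s = t.
  apply: IH (node_itv_sub_rcons Tsa xsa) (node_itv_sub_rcons Ttb xtb) => //.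
subst t; apply: eI; rewrite ?inE //.
wlog : a b Tsa Ttb xsa xtb / (e (rcons s a) <= e (rcons s b))%N => [wl|].
  by have [/wl|/ltnW/wl/esym] := leqP (e (rcons s a)) (e (rcons s b)); apply.
rewrite leq_eqVlt => /orP[/eqP//|ab]; exfalso.
move: xsa xtb; rewrite !node_itv_rcons //= !in_itv /=.
move=> /andP[_ x_lt] /andP[x_ge _].
move: (le_lt_trans x_ge x_lt); rewrite ltrD2l ltNge ler_wpM2l ?weight_ge0 //.
exact: le_children_cdf.
Qed.

(** The children's intervals cover the parent's. The right child is found from the least [n] whose
    cumulative endpoint exceeds [x]: its index is the predecessor of [n]. *)
Lemma node_itv_next t x : nodes T t -> ~ tmax T t -> node_itv t x ->
  exists a, nodes T (rcons t a) /\ node_itv (rcons t a) x.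
Proof.
move=> Tt tm xt.
have /andP[le_x lt_x] : left_end t <= x < left_end t + weight t.
  by move: xt; rewrite /node_itv /= in_itv.
have w_gt0 : 0 < weight t.
  by rewrite -(ltrD2l (left_end t)) addr0 (le_lt_trans le_x).
have [n x_n] : exists n, x < left_end t + weight t * children_cdf t n.
  have : (x - left_end t) / weight t < 1.
    by rewrite ltr_pdivrMr // mul1r ltrBlDl.
  move=> /(cvgr_gt _ (children_cdf_cvg Tt tm))[n _] /(_ _ (leqnn n)).
  by rewrite /= ltr_pdivrMr // ltrBlDl mulrC; exists n.
have ex : exists n, x < left_end t + weight t * children_cdf t n by exists n.
case: (ex_minnP ex) => -[|m] {n x_n}x_m m_min.
  by move: x_m; rewrite children_cdf0 mulr0 addr0 ltNge le_x.
have m_x : left_end t + weight t * children_cdf t m <= x.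
  by rewrite leNgt; apply/negP => /m_min; rewrite ltnn.
(* Without a child of index [m] the cumulative mass would not grow from [m] to [m.+1], yet [x]
   separates the two endpoints. *)
have [[s [ts es]]|ns] := pselect (exists s, succ T t s /\ e s = m); last first.
  move: x_m; rewrite ltNge children_cdfS.
  rewrite (_ : children_mass _ _ = 0) ?addr0 ?m_x //.
  rewrite -(children_cdf0 t); apply: eq_children_mass.
  by apply/seteqP; split=> s [ts] //= es; case: ns; exists s.
have /succP[Ts [a sE]] := ts; subst s; exists a; split=> //.
by rewrite node_itv_rcons //= in_itv /= es m_x.
Qed.

(** Either the interval of some maximal node contains [x], and that node is the branch, or
    [node_itv_next] can be iterated forever. In both cases [node_itv_inj] identifies every node
    whose interval contains [x]. *)
Lemma exists_branch x : node_itv [::] x ->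
  exists b : branch T, forall t : node T, cylinder t b <-> node_itv (sval t) x.
Proof.
move=> x0.
have [[t [tm xt]]|nomax] := pselect (exists t, tmax T t /\ node_itv t x).
  have [Tt _] := tm.
  have h : (inr @` tlim T `|` inl @` tmax T) (inl t : Defs.sequence A).
    by right; exists t.
  exists (exist _ _ h : branch T) => -[s Ts] /=.
  rewrite /cylinder /=; split=> [<-|xs].
    exact: node_itv_sub_take.
  have [st|ts] := leqP (size s) (size t).
    apply: (@node_itv_inj _ _ x) => //; first exact: tree_take.
      by rewrite size_takel.
    exact: node_itv_sub_take.
  (* A node longer than the maximal [t] would have [t] as a proper initial segment, making [t]
     inner. *)
  have tE : take (size t) s = t.
    apply: (@node_itv_inj _ _ x) => //; first exact: tree_take.
      by rewrite size_takel // ltnW.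
    exact: node_itv_sub_take.
  by have := inner_take Ts ts; rewrite tE => -[].
have next t : exists a, nodes T t /\ node_itv t x ->
    nodes T (rcons t a) /\ node_itv (rcons t a) x.
  have [[Tt xt]|nt] := pselect (nodes T t /\ node_itv t x).
    have [|a ha] := node_itv_next Tt _ xt; last by exists a.
    by move=> tm; apply: nomax; exists t.
  (* The choice function must be total: where the premise fails, the last entry of a child of the
     root serves as a filler. *)
  have [|a _] := node_itv_next (tree_nil T) _ x0; last by exists a => /nt.
  by move=> tm; apply: nomax; exists [::].
have /choice[g gP] := next.
pose f n := iter n (fun t => rcons t (g t)) [::].
have fT n : nodes T (f n) /\ node_itv (f n) x.
  by elim: n => [|n IH]; [split=> //; exact: tree_nil|exact: gP].
have fE n : mkseq (g \o f) n = f n.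
  by elim: n => // n IH; rewrite mkseqS IH.
have h : (inr @` tlim T `|` inl @` tmax T) (inr (g \o f) : Defs.sequence A).
  by left; exists (g \o f) => // n; rewrite fE; have [] := fT n.
exists (exist _ _ h : branch T) => -[s Ts] /=.
rewrite /cylinder /= fE; split=> [<-|xs].
  by have [] := fT (size s).
have [Tf xf] := fT (size s).
by apply: (@node_itv_inj _ _ x) => //; rewrite -fE size_mkseq.
Qed.

Lemma Xi_weight (t : node T) : Xi P [set t] = (weight (sval t))%:E.
Proof.
rewrite Xi_set1 /weight -prodEFin.
apply: eq_bigr => k _; rewrite /step.
by rewrite (children_massE (inner_take (svalP t) (ltn_ord k))).
Qed.

Lemma lebesgue_node_itv t : lebesgue_measure (node_itv t) = (weight t)%:E.
Proof.
rewrite /node_itv lebesgue_measure_itv /= lte_fin ltrDl -EFinB.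
by rewrite addrAC subrr add0r; case: ltgtP (weight_ge0 t) => // <-.
Qed.

End intervals.

(** * The branch map, its law under Lebesgue measure, and uniqueness *)

Section law.
Context (R : realType) (A : Type) (P : probability_tree R A).
Local Notation T := (ptree P).
Local Open Scope ring_scope.

Lemma branch_mfun (e : seq A -> nat) : {in nodes T &, injective e} ->
  exists f : {mfun measurableTypeR R >-> borel_branch T}, forall t : node T,
    f @^-1` (cylinder t) `&` `[0, 1[ = node_itv P e (sval t).
Proof.
move=> eI; pose D : set (measurableTypeR R) := `[0, 1[%classic.
have : forall x, exists b : borel_branch T, D x ->
    forall t : node T, cylinder t b <-> node_itv P e (sval t) x.
  move=> x; have [Dx|nDx] := pselect (D x); last by exists point.
  have [|b hb] := @exists_branch _ _ P e eI x; last by exists b.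
  by rewrite node_itv_nil.
move=> /choice[f fP].
have f_cyl (t : node T) : D `&` f @^-1` (cylinder t) = node_itv P e (sval t).
  apply/seteqP; split=> [x [Dx]|x xt]; first by move/(fP _ Dx).
  have Dx : D x.
    rewrite /D -(node_itv_nil P e) -(take0 (sval t)).
    exact: (node_itv_sub_take eI 0%N (svalP t) xt).
  by split=> //; apply/(fP _ Dx).
have mD : measurable D by exact: measurable_itv.
(* Making [f] constant, equal to [point], off [D] reduces measurability to [D]. There it suffices to
   test the pi-system, whose preimages are empty or intervals. *)
have mf : measurable_fun setT (f \_ D).
  apply/(measurable_restrictT _ mD).
  apply: (@measurability _ _ (measurableTypeR R) (borel_branch T) _ _ _
    (borel_branchE (ptree_countable P))).
  move=> _ [B [->|[t ->]] <-]; first by rewrite preimage_set0 setI0.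
  rewrite f_cyl; exact: measurable_itv.
exists (mfun_Sub (mem_set mf)) => t.
rewrite -f_cyl setIC; apply/seteqP; split=> x [Dx] /=.
  by rewrite patchT ?inE.
by split=> //=; rewrite patchT ?inE.
Qed.

(** The uniform law on the unit interval, kept as a measure on the whole line to avoid a subtype. *)
Definition lebesgue01 : set (measurableTypeR R) -> \bar R :=
  mrestr lebesgue_measure (measurable_itv `[0%R : R, 1[).

HB.instance Definition _ := Measure.on lebesgue01.

Let lebesgue01_setT : lebesgue01 setT = 1%E.
Proof.
rewrite /lebesgue01 /mrestr setTI lebesgue_measure_itv /= lte_fin ltr01.
by rewrite oppr0 adde0.
Qed.

HB.instance Definition _ :=
  Measure_isProbability.Build _ _ R lebesgue01 lebesgue01_setT.

End law.

(* Uniqueness is equality on the Borel sets: a measure in this library is a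
   function on all subsets, with arbitrary values outside the sigma-algebra. *)
Theorem theorem4p31 (R : realType) (A : Type) (P : probability_tree R A) :
  exists lambda : probability (borel_branch (ptree P)) R,
    (forall t : node (ptree P), lambda (cylinder t) = Xi P [set t]) /\
    (forall lambda' : probability (borel_branch (ptree P)) R,
       (forall t : node (ptree P), lambda' (cylinder t) = Xi P [set t]) ->
       forall B : set (borel_branch (ptree P)),
         measurable B -> lambda' B = lambda B).
Proof.
have /countable_injP[e eI] := ptree_countable P.
have [f fP] := branch_mfun eI.
have [lambda lambdaE] : exists lambda : probability (borel_branch (ptree P)) R,
    forall t : node (ptree P), lambda (cylinder t) = Xi P [set t].
  exists (distribution (@lebesgue01 R) f) => t.
  rewrite Xi_weight -(lebesgue_node_itv P e) -fP //.
exists lambda; split=> // lambda' lambda'E B mB.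
(* The exhausting sequence is constantly the whole space, which is the cylinder of the root and has
   finite measure. *)
apply: (@measure_unique _ _ (borel_branch (ptree P)) _ (fun=> setT)
  (borel_branchE (ptree_countable P)) (@pi_cylinder_setI _ _)) => //.
- by move=> _; right; exists point; rewrite cylinder_nil.
- by rewrite bigcup_const.
- move=> _ [->|[t ->]]; first by rewrite !measure0.
  exact: etrans (lambda'E t) (esym (lambdaE t)).
- by move=> _; rewrite (le_lt_trans (probability_le1 _ _)) ?ltry.
Qed.
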